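(* Let $G_1$ be the connected and simply connected Lie group whose Lie algebra $\mathfrak{g}_1$ has a basis $\{x,y,z\}$ with $[x,y]=0$, $[z,x]=y$, $[z,y]=-x+2y$. Let $Q=\begin{bmatrix}-2&-1&0\\1&1&0\\0&0&1\end{bmatrix}$. Then any left invariant Lorentzian metric on $G_1$ is equivalent up to automorphism to a metric whose associated matrix (with respect to $\{x,y,z\}$) is of the form $Q^tMQ$, where $M$ is of the form $$ \begin{bmatrix}0&0&1\\0&\mu&0\\1&0&0\end{bmatrix},\ \begin{bmatrix}\mu&0&0\\0&0&1\\0&1&0\end{bmatrix},\ \begin{bmatrix}1&0&0\\0&-\nu&0\\0&0&\mu\end{bmatrix},\ \begin{bmatrix}1&0&0\\0&\nu&0\\0&0&-\mu\end{bmatrix},\ \begin{bmatrix}-1&0&0\\0&\nu&0\\0&0&\mu\end{bmatrix},\ \begin{bmatrix}0&1&0\\1&0&0\\0&0&\mu\end{bmatrix},\ \text{or}\ \begin{bmatrix}0&-1&0\\-1&0&0\\0&0&\mu\end{bmatrix}, $$ where $\mu>0$ and $\nu>0$.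
   Context: A left invariant Lorentzian metric $h$ on a connected three-dimensional Lie group $G$ is identified with a nondegenerate symmetric bilinear form of signature $(+,+,-)$ on its Lie algebra $\mathfrak{g}$. With respect to a fixed basis of $\mathfrak{g}$, its associated matrix $[h]$ is the symmetric matrix with $h(u,v)=[u]^t[h][v]$, where $[u]$ is the coordinate column vector of $u$. Two left invariant Lorentzian metrics $h,h'$ on $G$ are equivalent up to automorphism if there is a Lie algebra automorphism $\varphi\in\mathrm{Aut}(\mathfrak{g})$ with $[h']=[\varphi]^t[h][\varphi]$. $Q$ is the transition matrix from coordinates in $\{x,y,z\}$ to coordinates in the basis $x_1=-x+y$, $x_2=-x+2y$, $x_3=z$ of $\mathfrak{g}_1$; thus the metric with matrix $Q^tMQ$ in $\{x,y,z\}$ is the one with matrix $M$ in $\{x_1,x_2,x_3\}$. *)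

(* Defs.v *)
From mathcomp Require Import all_boot all_order all_algebra.
From mathcomp Require Import sesquilinear reals.

Set Implicit Arguments.
Unset Strict Implicit.
Unset Printing Implicit Defensive.

Import Order.TTheory GRing.Theory Num.Theory.
Local Open Scope ring_scope.

Section LieAlgebra.
Variables (F : fieldType) (V : vectType F) (br : {bilinear V -> V -> V}).

Definition lie_bracket : Prop :=
  (forall u, br u u = 0) /\
  (forall u v w, br u (br v w) + br v (br w u) + br w (br u v) = 0).

Definition lie_automorphism (phi : 'End(V)) : Prop :=
  bijective phi /\ {morph phi : u v / br u v}.

End LieAlgebra.

Section Coordinates.
Variables (F : fieldType) (V : vectType F) (n : nat) (b : n.-tuple V).

Definition vec_col (u : V) : 'cV[F]_n := \col_i coord b i u.

(* Columns are images of basis vectors; the library's [mxof] is the transpose,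
   as it acts on row vectors. *)
Definition end_mx (phi : 'End(V)) : 'M[F]_n :=
  \matrix_(i, j) coord b i (phi (tnth b j)).

Definition form_mx (h : {symmetric V}) : 'M[F]_n :=
  \matrix_(i, j) h (tnth b i) (tnth b j).

Lemma vec_col_end (phi : 'End(V)) (u : V) : basis_of fullv b ->
  vec_col (phi u) = end_mx phi *m vec_col u.
Proof.
move=> bb; apply/colP => i; rewrite !mxE {1}(coord_basis bb (memvf u)).
rewrite !linear_sum /=; apply: eq_bigr => j _.
by rewrite !linearZ /= !mxE mulrC (tnth_nth 0).
Qed.

Lemma form_mxE (h : {symmetric V}) (u v : V) : basis_of fullv b ->
  h u v = ((vec_col u)^T *m form_mx h *m vec_col v) 0 0.
Proof.
move=> bb; rewrite !mxE {1}(coord_basis bb (memvf v)) linear_sumr /=.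
apply: eq_bigr => j _; rewrite linearZr_LR /= {1}(coord_basis bb (memvf u)).
rewrite linear_sumlz !mxE mulrC; congr (_ * _).
by apply: eq_bigr => i _; rewrite linearZl_LR !mxE !(tnth_nth 0).
Qed.

End Coordinates.

Section Metrics.
Variables (R : realType) (V : vectType R).

Definition signature_ppm (h : {symmetric V}) : Prop :=
  exists e : 3.-tuple V,
    [/\ basis_of fullv e,
        forall i j : 'I_3, i != j -> h (tnth e i) (tnth e j) = 0
      & [/\ 0 < h e`_0 e`_0, 0 < h e`_1 e`_1 & h e`_2 e`_2 < 0]].

(* A left invariant Lorentzian metric on a Lie group is identified with its
   value at the identity, a bilinear form on the Lie algebra V. *)
Definition lorentzian (h : {symmetric V}) : Prop :=
  nondegenerate h /\ signature_ppm h.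

Definition equiv_up_to_aut (br : {bilinear V -> V -> V}) (n : nat)
    (b : n.-tuple V) (h h' : {symmetric V}) : Prop :=
  exists phi : 'End(V), lie_automorphism br phi /\
    form_mx b h' = (end_mx b phi)^T *m form_mx b h *m end_mx b phi.

End Metrics.

Section Matrices.
Variable R : realType.

Definition mx3 (rows : seq (seq R)) : 'M[R]_3 :=
  \matrix_(i, j) nth 0 (nth [::] rows i) j.

Definition Q_mx : 'M[R]_3 :=
  mx3 [:: [:: -2; -1; 0];
          [::  1;  1; 0];
          [::  0;  0; 1]].

Definition normal_forms (mu nu : R) : seq 'M[R]_3 :=
  [:: mx3 [:: [:: 0; 0; 1]; [:: 0; mu; 0]; [:: 1; 0; 0]];
      mx3 [:: [:: mu; 0; 0]; [:: 0; 0; 1]; [:: 0; 1; 0]];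
      mx3 [:: [:: 1; 0; 0]; [:: 0; - nu; 0]; [:: 0; 0; mu]];
      mx3 [:: [:: 1; 0; 0]; [:: 0; nu; 0]; [:: 0; 0; - mu]];
      mx3 [:: [:: -1; 0; 0]; [:: 0; nu; 0]; [:: 0; 0; mu]];
      mx3 [:: [:: 0; 1; 0]; [:: 1; 0; 0]; [:: 0; 0; mu]];
      mx3 [:: [:: 0; -1; 0]; [:: -1; 0; 0]; [:: 0; 0; mu]]].

End Matrices.

(* Main.v *)
(* In the basis x1 = -x + y, x2 = -x + 2y, x3 = z the only nonzero brackets are
[x3, x1] = x1 and [x3, x2] = x1 + x2, so for a != 0 the maps x1 |-> a x1,
x2 |-> b x1 + a x2, x3 |-> c x1 + d x2 + x3 are automorphisms.  If h is
nondegenerate on the plane <x1, x2>, one chooses c and d to make x3 orthogonal to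
that plane, and then b to diagonalize h there, or to make x2 isotropic when x1 is.
Otherwise h has rank 1 on the plane; b moves x2 into the kernel unless x1 already
spans it, and c and d then make x3 isotropic and orthogonal to the remaining
vector.  The parameter a normalizes one coefficient, and the signs of the others
are dictated by det h < 0 and by the reverse Cauchy-Schwarz inequality. *)

Require Import Defs.
From mathcomp Require Import all_boot all_order all_algebra.
From HB Require Import structures.
From mathcomp Require Import sesquilinear reals ring lra.

Set Implicit Arguments.
Unset Strict Implicit.
Unset Printing Implicit Defensive.

Import Order.TTheory GRing.Theory Num.Theory.
Local Open Scope ring_scope.

(** * Reverse Cauchy-Schwarz inequality in diagonal coordinates *)

Lemma reverse_cauchy_schwarz3 (R : realFieldType) (p q r a b c a' b' c' : R) :
    0 < p -> 0 < q -> r < 0 -> a * a * p + b * b * q + c * c * r < 0 ->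
  (a * a * p + b * b * q + c * c * r) * (a' * a' * p + b' * b' * q + c' * c' * r)
    <= (a * a' * p + b * b' * q + c * c' * r) ^+ 2.
Proof.
move=> p0 q0 r0 neg; rewrite -subr_ge0.
(* For u = (a, b, c) and u' = (a', b', c'), the vector c' u - c u' has coordinates ([be], [ga], 0),
   so it lies in the positive plane. Replacing u' by it multiplies the Gram determinant by c^2. *)
set G := (X in 0 <= X); pose be := a * c' - a' * c; pose ga := b * c' - b' * c.
have c2 : 0 < c ^+ 2 by nra.
rewrite -(pmulr_rge0 _ c2).
(* Lagrange's identity; c != 0 because c is the negative direction. *)
have -> : c ^+ 2 * G =
    (p * a * be + q * b * ga) ^+ 2
    - (a * a * p + b * b * q + c * c * r) * (p * be ^+ 2 + q * ga ^+ 2).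
  by rewrite /G /be /ga; ring.
rewrite addr_ge0 ?sqr_ge0 // -mulNr mulr_ge0 ?oppr_ge0 ?(ltW neg) //.
by rewrite addr_ge0 // mulr_ge0 ?sqr_ge0 // ltW.
Qed.

(** * Congruence of symmetric 3x3 matrices under the automorphism matrices *)

Section Matrices.
Variable R : realType.
Implicit Types A H : 'M[R]_3.

Lemma mx3_eta A :
  A = mx3 [:: [:: A 0 0; A 0 1; A 0 2%:R]; [:: A 1 0; A 1 1; A 1 2%:R];
              [:: A 2%:R 0; A 2%:R 1; A 2%:R 2%:R]].
Proof.
by apply/matrixP => -[[|[|[]]] // ?] [[|[|[]]] // ?]; rewrite mxE /=;
  congr (A _ _); apply: val_inj.
Qed.

Lemma tr_mx3 (a b c d e f g h i : R) :
  (mx3 [:: [:: a; b; c]; [:: d; e; f]; [:: g; h; i]])^T =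
  mx3 [:: [:: a; d; g]; [:: b; e; h]; [:: c; f; i]].
Proof.
by apply/matrixP => -[[|[|[]]] // ?] [[|[|[]]] // ?]; rewrite !mxE.
Qed.

Lemma mulmx3 (a b c d e f g h i a' b' c' d' e' f' g' h' i' : R) :
  mx3 [:: [:: a; b; c]; [:: d; e; f]; [:: g; h; i]] *m
  mx3 [:: [:: a'; b'; c']; [:: d'; e'; f']; [:: g'; h'; i']] =
  mx3 [:: [:: a * a' + b * d' + c * g'; a * b' + b * e' + c * h';
              a * c' + b * f' + c * i'];
          [:: d * a' + e * d' + f * g'; d * b' + e * e' + f * h';
              d * c' + e * f' + f * i'];
          [:: g * a' + h * d' + i * g'; g * b' + h * e' + i * h';
              g * c' + h * f' + i * i']].
Proof.
by apply/matrixP => -[[|[|[]]] // ?] [[|[|[]]] // ?];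
  rewrite !mxE !big_ord_recl big_ord0 !mxE /= addr0 addrA.
Qed.

Lemma det_mx3 (a b c d e f g h i : R) :
  \det (mx3 [:: [:: a; b; c]; [:: d; e; f]; [:: g; h; i]]) =
  a * (e * i - f * h) - b * (d * i - f * g) + c * (d * h - e * g).
Proof.
rewrite (expand_det_row _ 0) !big_ord_recl big_ord0 /cofactor.
by rewrite !(expand_det_row _ 0) !big_ord_recl !big_ord0 /cofactor !det_mx11
  !mxE /=; ring.
Qed.

(* The matrix of an automorphism of g1 in the basis x1, x2, x3. *)
Definition aut_mx (a b c d : R) : 'M[R]_3 :=
  mx3 [:: [:: a; b; c]; [:: 0; a; d]; [:: 0; 0; 1]].

Lemma exists_sqr_inv (p : R) : 0 < p -> exists2 a, a != 0 & p = a ^- 2.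
Proof.
move=> p0; exists (Num.sqrt p)^-1; first by rewrite invr_neq0 // gt_eqF ?sqrtr_gt0.
by rewrite exprVn invrK sqr_sqrtr // ltW.
Qed.

Definition sym_mx (p q s t w m : R) : 'M[R]_3 :=
  mx3 [:: [:: p; q; s]; [:: q; t; w]; [:: s; w; m]].

Definition pull_mx H a b c d := (aut_mx a b c d)^T *m H *m aut_mx a b c d.

(** [u] and [v] are the products of x1 and x2 with c x1 + d x2 + x3, the image of x3; both vanish
    when that image is orthogonal to the plane. *)
Lemma pull_sym_mx (p q s t w m a b c d : R) :
  let u := p * c + q * d + s in let v := q * c + t * d + w in
  pull_mx (sym_mx p q s t w m) a b c d =
  sym_mx (a ^+ 2 * p) (a * (b * p + a * q)) (a * u)
    (b ^+ 2 * p + 2 * a * b * q + a ^+ 2 * t) (b * u + a * v)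
    (c * u + d * v + c * s + d * w + m).
Proof.
rewrite /= /pull_mx /sym_mx tr_mx3 !mulmx3.
by congr (mx3 [:: [:: _; _; _]; [:: _; _; _]; [:: _; _; _]]); ring.
Qed.

Lemma det_sym_mx (p q s t w m : R) :
  \det (sym_mx p q s t w m) =
  p * t * m + 2 * q * s * w - p * w ^+ 2 - t * s ^+ 2 - m * q ^+ 2.
Proof. by rewrite det_mx3; ring. Qed.

Lemma normal_form_rank1 (p q s t w m : R) :
    p * t = q ^+ 2 -> \det (sym_mx p q s t w m) < 0 ->
  exists a b c d mu nu, [/\ a != 0, 0 < mu, 0 < nu
    & pull_mx (sym_mx p q s t w m) a b c d \in normal_forms mu nu].
Proof.
rewrite det_sym_mx => ptq; have [p0|p_neq0] := eqVneq p 0.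
  have q0 : q = 0 by apply/eqP; rewrite -sqrf_eq0 -ptq p0 mul0r.
  rewrite p0 q0 => detH; have {}detH : 0 < s ^+ 2 * t by nra.
  have s0 : s != 0 by apply: contraTneq detH => ->; rewrite expr0n mul0r ltxx.
  have t0 : 0 < t by rewrite pmulr_rgt0 // exprn_even_gt0 in detH.
  have tn0 := lt0r_neq0 t0.
  (* With x1 in the kernel on the plane, [d] makes x3 orthogonal to x2, then [c] makes it isotropic,
     and [a] = 1/s turns its product with x1 into 1. The final 1 is a placeholder for [nu], absent
     from this form. *)
  exists s^-1, 0, ((w ^+ 2 / t - m) / (2 * s)), (- w / t), (t / s ^+ 2), 1.
  split; [by rewrite invr_neq0 | by rewrite divr_gt0 // exprn_even_gt0
    | exact: ltr01 |].
  rewrite inE; apply/orP; left; apply/eqP; rewrite pull_sym_mx.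
  by congr (mx3 [:: [:: _; _; _]; [:: _; _; _]; [:: _; _; _]]);
    field; rewrite ?s0 ?tn0.
have -> : t = q ^+ 2 / p by rewrite -ptq mulrC mulKf.
(* [k] is the product of x3 with x2 - (q/p) x1, which spans the kernel of the form on the plane. *)
set k := w - q * s / p; have -> : w = k + q * s / p by rewrite subrK.
set D := (X in X < 0); have {D}-> : D = - (p * k ^+ 2) by rewrite /D; field.
rewrite oppr_lt0 => detH.
have k0 : k != 0 by apply: contraTneq detH => ->; rewrite expr0n mulr0 ltxx.
have p0 : 0 < p by rewrite pmulr_lgt0 // exprn_even_gt0 in detH.
clearbody k.
(* The witness [b] sends x2 to a multiple of the kernel vector and [c] makes x3 orthogonal to x1;
   the square of x3 is then 2 d k - s^2/p + m, which this [d] annihilates. *)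
pose d := (s ^+ 2 / p - m) / (2 * k).
exists k^-1, (- q / p / k), (- (s + q * d) / p), d, (p / k ^+ 2), 1.
split; [by rewrite invr_neq0 | by rewrite divr_gt0 // exprn_even_gt0
  | exact: ltr01 |].
rewrite !inE; apply/orP; right; apply/orP; left; apply/eqP; rewrite pull_sym_mx.
by congr (mx3 [:: [:: _; _; _]; [:: _; _; _]; [:: _; _; _]]);
  rewrite /d; field; rewrite ?k0 ?p_neq0.
Qed.

(** The values of c and d solve u = v = 0 by Cramer's rule; the last entry is then the Schur
    complement of the plane block. *)
Lemma pull_orthogonal (p q s t w m a b : R) (D := p * t - q ^+ 2) : D != 0 ->
  pull_mx (sym_mx p q s t w m) a b ((q * w - t * s) / D) ((q * s - p * w) / D) =
  sym_mx (a ^+ 2 * p) (a * (b * p + a * q)) 0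
    (b ^+ 2 * p + 2 * a * b * q + a ^+ 2 * t) 0
    (\det (sym_mx p q s t w m) / D).
Proof.
move=> D0; rewrite pull_sym_mx det_sym_mx.
by congr (mx3 [:: [:: _; _; _]; [:: _; _; _]; [:: _; _; _]]);
  rewrite /D; field; rewrite ?D0.
Qed.

(** A Gram-Schmidt step on the plane yields diag(sg p, a^2 D/p, det/D), and the signs of p and D
    select one of the three diagonal forms. The last hypothesis rules out p < 0 < D, a negative
    definite plane. *)
Lemma normal_form_nonisotropic (p q s t w m : R) :
    p != 0 -> p * t != q ^+ 2 -> \det (sym_mx p q s t w m) < 0 ->
    (p < 0 -> p * t <= q ^+ 2) ->
  exists a b c d mu nu, [/\ a != 0, 0 < mu, 0 < nu
    & pull_mx (sym_mx p q s t w m) a b c d \in normal_forms mu nu].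
Proof.
move=> p_neq0 D_neq0 detH neg.
have [a a0 pE] : exists2 a, a != 0 & `|p| = a ^- 2.
  by apply: exists_sqr_inv; rewrite normr_gt0.
have a2 : 0 < a ^+ 2 by rewrite exprn_even_gt0.
have a2p : a ^+ 2 * p = Num.sg p.
  by rewrite {1}[p]numEsg pE mulrCA divff ?mulr1 // expf_neq0.
have D0 : p * t - q ^+ 2 != 0 by rewrite subr_eq0.
set D := p * t - q ^+ 2 in D0.
pose b := - q * a / p; exists a, b.
exists ((q * w - t * s) / D), ((q * s - p * w) / D).
rewrite pull_orthogonal // a2p -/D.
have -> : b * p + a * q = 0 by rewrite /b; field.
have -> : b ^+ 2 * p + 2 * a * b * q + a ^+ 2 * t = a ^+ 2 * (D / p).
  by rewrite /b /D; field.
rewrite mulr0; set B := a ^+ 2 * _; set mu := _ / _.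
have [p0|] := boolP (p < 0).
  have {}neg : D < 0 by rewrite lt_neqAle D0 subr_le0 neg.
  exists mu, B; rewrite ltr0_sg // !inE eqxx ?orbT; split=> //.
    by rewrite /mu nmulr_lgt0 // invr_lt0.
  by rewrite /B pmulr_rgt0 // nmulr_lgt0 // invr_lt0.
rewrite -leNgt le_eqVlt eq_sym (negbTE p_neq0) /= => p0.
rewrite (gtr0_sg p0); have [Dn|] := boolP (D < 0).
  exists mu, (- B); rewrite !inE !opprK eqxx ?orbT; split=> //.
    by rewrite /mu nmulr_lgt0 // invr_lt0.
  by rewrite oppr_gt0 /B pmulr_rlt0 // pmulr_llt0 // invr_gt0.
rewrite -leNgt le_eqVlt eq_sym (negbTE D0) /= => Dp.
exists (- mu), B; rewrite !inE !opprK eqxx ?orbT; split=> //.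
  by rewrite oppr_gt0 /mu pmulr_llt0 // invr_gt0.
by rewrite /B pmulr_rgt0 // divr_gt0.
Qed.

Lemma normal_form_isotropic (q s t w m : R) :
    q != 0 -> \det (sym_mx 0 q s t w m) < 0 ->
  exists a b c d mu nu, [/\ a != 0, 0 < mu, 0 < nu
    & pull_mx (sym_mx 0 q s t w m) a b c d \in normal_forms mu nu].
Proof.
move=> q0 detH.
have [a a0 qE] : exists2 a, a != 0 & `|q| = a ^- 2.
  by apply: exists_sqr_inv; rewrite normr_gt0.
have a2q : a ^+ 2 * q = Num.sg q.
  by rewrite {1}[q]numEsg qE mulrCA divff ?mulr1 // expf_neq0.
have D0 : 0 * t - q ^+ 2 < 0 by rewrite mul0r sub0r oppr_lt0 exprn_even_gt0.
(* This [b] solves 2 a b q + a^2 t = 0, making the image of x2 isotropic. *)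
exists a, (- a * t / (2 * q)).
set D := _ - _ in D0.
exists ((q * w - t * s) / D), ((q * s - 0 * w) / D), (\det (sym_mx 0 q s t w m) / D), 1.
split=> //; first by rewrite nmulr_lgt0 // invr_lt0.
rewrite pull_orthogonal ?lt_eqF // -/D.
set B := (_ + _ + a ^+ 2 * t); have {B}-> : B = 0 by rewrite /B; field.
(* Only a^2 multiplies q, so its sign survives and separates the last two forms. *)
rewrite !mulr0 add0r mulrA -expr2 a2q.
have [q1|q1] := ltP q 0; first by rewrite ltr0_sg // !inE eqxx !orbT.
by rewrite gtr0_sg ?lt_def ?q0 // !inE eqxx !orbT.
Qed.

(** The signature enters through two consequences: a negative determinant, and a plane <x1, x2> that
    is not negative definite. *)
Lemma normal_form H : H^T = H -> \det H < 0 ->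
    (H 0 0 < 0 -> H 0 0 * H 1 1 <= H 0 1 ^+ 2) ->
  exists a b c d mu nu, [/\ a != 0, 0 < mu, 0 < nu
    & pull_mx H a b c d \in normal_forms mu nu].
Proof.
move=> symH.
have : H = sym_mx (H 0 0) (H 0 1) (H 0 2%:R) (H 1 1) (H 1 2%:R) (H 2%:R 2%:R).
  have symE i j : H i j = H j i by rewrite -{1}symH mxE.
  by rewrite [LHS]mx3_eta (symE 1) (symE 2%:R 0) (symE 2%:R 1).
move: (H 0 0) (H 0 1) (H 0 2%:R) (H 1 1) (H 1 2%:R) (H 2%:R 2%:R) => p q s t w m.
move=> {symH}-> detH neg; have [|ptq] := eqVneq (p * t) (q ^+ 2).
  by move/normal_form_rank1; apply.
have [p0|p0] := eqVneq p 0; last exact: normal_form_nonisotropic.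
rewrite p0 in ptq detH *; apply: normal_form_isotropic => //.
by apply: contraNneq ptq => ->; rewrite mul0r expr0n.
Qed.
End Matrices.

(** * Matrices of a symmetric form and consequences of its signature *)

Section Forms.
Variables (R : realType) (V : vectType R).
Implicit Types (h : {symmetric V}) (u v : V).

Lemma symmetricC h u v : h u v = h v u.
Proof. by rewrite hermC /= expr0 mul1r. Qed.

Lemma form_mx_change m n (e : m.-tuple V) (f : n.-tuple V) (P : 'M_(m, n)) h :
    (forall j, tnth f j = \sum_i P i j *: tnth e i) ->
  form_mx f h = P^T *m form_mx e h *m P.
Proof.
move=> fE; apply/matrixP => i j; rewrite !mxE !fE linear_sumr.
apply: eq_bigr => k _; rewrite linearZr_LR /= linear_sumlz !mxE mulrC.
by congr (_ * _); apply: eq_bigr => l _; rewrite linearZl_LR !mxE.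
Qed.

Lemma basis_expand n (e : n.-tuple V) u : basis_of fullv e ->
  u = \sum_i coord e i u *: tnth e i.
Proof.
by move=> be; rewrite {1}(coord_basis be (memvf u)); under eq_bigr do rewrite -tnth_nth.
Qed.

(** In the orthogonal basis given by the signature the determinant is a negative product, and it
    equals the determinant in [e] times the square of det P. *)
Lemma det_form_mx_lt0 h (e : 3.-tuple V) : signature_ppm h ->
  basis_of fullv e -> \det (form_mx e h) < 0.
Proof.
move=> [s [bs ortho [s0 s1 s2]]] be.
pose P := \matrix_(i, j) coord e i (tnth s j).
have sE j : tnth s j = \sum_i P i j *: tnth e i.
  by rewrite {1}(basis_expand (tnth s j) be); apply: eq_bigr => i _; rewrite mxE.
have /(congr1 determinant) := form_mx_change h sE.
have -> : form_mx s h = diag_mx (\row_i h (tnth s i) (tnth s i)).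
  apply/matrixP => i j; rewrite !mxE; have [->|/ortho->] := eqVneq i j.
    by rewrite mulr1n.
  by rewrite mulr0n.
rewrite det_diag !big_ord_recl big_ord0 !mxE !(tnth_nth 0) /= mulr1.
rewrite !det_mulmx det_tr => detE.
have : h s`_0 s`_0 * (h s`_1 s`_1 * h s`_2 s`_2) < 0.
  by rewrite pmulr_rlt0 // pmulr_rlt0.
rewrite detE mulrAC -expr2; case: (ltrP (\det (form_mx e h)) 0) => // d0.
by rewrite ltNge mulr_ge0 // sqr_ge0.
Qed.

Lemma reverse_cauchy_schwarz h u v : signature_ppm h ->
  h u u < 0 -> h u u * h v v <= h u v ^+ 2.
Proof.
move=> [s [bs ortho [s0 s1 s2]]].
have hE w w' : h w w' = \sum_i coord s i w * coord s i w' * h s`_i s`_i.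
  rewrite {1}(basis_expand w bs) {1}(basis_expand w' bs) linear_sumr.
  apply: eq_bigr => i _; rewrite linearZr_LR /= linear_sumlz (bigD1 i) //=.
  rewrite big1 ?addr0 => [|j ji]; last by rewrite linearZl_LR /= ortho ?mulr0.
  by rewrite linearZl_LR /= (tnth_nth 0) mulrCA mulrA.
rewrite !hE !big_ord_recl !big_ord0 /= !addr0 !addrA.
exact: reverse_cauchy_schwarz3.
Qed.
End Forms.

(** * Pullback of a Lorentzian metric along a linear bijection *)

Section Pullback.
Variables (R : realType) (V : vectType R) (phi : 'End(V)) (h : {symmetric V}).

Definition pullback (u v : V) : R := h (phi u) (phi v).

Fact pullback_bilinear : bilinear_for ( *%R) (idfun \; *%R) pullback.
Proof.
split=> w a u v; rewrite /pullback linearP.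
  by rewrite linearPl.
by rewrite linearPr.
Qed.

HB.instance Definition _ :=
  bilinear_isBilinear.Build R V V R ( *%R) (idfun \; *%R) pullback pullback_bilinear.

Fact pullback_symmetric u v : pullback u v = (-1) ^+ false * idfun (pullback v u).
Proof. exact: hermC. Qed.

HB.instance Definition _ :=
  isHermitianSesquilinear.Build R V false idfun pullback pullback_symmetric.
End Pullback.

(** As [phi] is onto, it maps the radical of the pullback into that of [h]; the preimages of an
    orthogonal basis for [h] are one for the pullback, with the same squares. *)
Lemma pullback_lorentzian (R : realType) (V : vectType R) (phi : 'End(V))
    (h : {symmetric V}) :
  bijective phi -> lorentzian h -> lorentzian (pullback phi h).
Proof.
move=> bphi [ndeg [e [be ortho sgn]]].
have ker0 : lker phi == 0%VS by apply/lker0P/bij_inj.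
have phiK := lker0_lfunVK ker0; split.
  apply/eqP/vspaceP => u; rewrite memv0; apply/mem_orthovP/eqP; last first.
    by move=> -> v _; rewrite /= /pullback linear0 linear0l.
  move=> ortho_u; apply: (lker0P ker0); rewrite linear0; apply/eqP.
  rewrite -memv0 -(eqP ndeg); apply/mem_orthovP => v _.
  by rewrite -(phiK v); apply: ortho_u; rewrite memvf.
have kerV : lker phi^-1%VF == 0%VS by apply/lker0P/(can_inj phiK).
have size_e : size e = 3%N by rewrite size_tuple.
exists (map_tuple phi^-1%VF e); split.
- by rewrite -(lker0_limgf kerV) limg_basis_of // (eqP kerV) capv0.
- by move=> i j /ortho; rewrite !tnth_map /= /pullback !phiK.
- by rewrite /= /pullback !(nth_map 0) ?size_e // !phiK.
Qed.

(** * Linear maps and Lie automorphisms prescribed on a basis *)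

Lemma alt_anticomm (R : nzRingType) (V W : lmodType R)
    (br : {bilinear V -> V -> W}) :
  (forall u, br u u = 0) -> forall u v, br u v = - br v u.
Proof.
move=> alt u v; apply/eqP; rewrite -addr_eq0 -(alt (u + v)) (linearDl br).
by rewrite !(linearDr br) !alt add0r addr0.
Qed.

Section Linear.
Variables (R : fieldType) (V : vectType R) (n : nat) (e : n.-tuple V).
Hypothesis be : basis_of fullv e.

Lemma lfun_basis_ext (f g : 'End(V)) :
  (forall j, f (tnth e j) = g (tnth e j)) -> f = g.
Proof.
move=> fg; apply/lfunP => u; rewrite (coord_basis be (memvf u)) !linear_sum.
by apply: eq_bigr => i _; rewrite !linearZ /= -tnth_nth fg.
Qed.

Lemma exists_lfun (F : 'I_n -> V) : exists f : 'End(V), forall j, f (tnth e j) = F j.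
Proof.
have [f fE] := linear_of_free e [tuple F j | j < n].
exists (linfun f) => j; rewrite lfunE /=.
have {}fE : map_tuple f e = [tuple F j | j < n].
  by apply/val_inj/fE; rewrite ?(basis_free be) // size_map size_enum_ord size_tuple.
by have := congr1 (fun t => tnth t j) fE; rewrite tnth_map tnth_mktuple.
Qed.

Lemma exists_bij_lfun (A : 'M[R]_n) : A \in unitmx ->
  exists2 f : 'End(V), bijective f & forall j, f (tnth e j) = \sum_i A i j *: tnth e i.
Proof.
move=> unitA.
have [f fE] := exists_lfun (fun j => \sum_i A i j *: tnth e i).
have [g gE] := exists_lfun (fun j => \sum_i invmx A i j *: tnth e i).
(* Columns hold images of basis vectors, so composition is the matrix product; this is applied to
   [A] and [invmx A] in both orders. *)
have comp_id (B C : 'M[R]_n) (f1 f2 : 'End(V)) : B *m C = 1%:M ->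
    (forall j, f1 (tnth e j) = \sum_i B i j *: tnth e i) ->
    (forall j, f2 (tnth e j) = \sum_i C i j *: tnth e i) -> cancel f2 f1.
  move=> BC f1E f2E u.
  suff /lfunP/(_ u) : (f1 \o f2)%VF = \1%VF by rewrite !lfunE.
  apply: lfun_basis_ext => j; rewrite !lfunE /= f2E linear_sum.
  transitivity (\sum_k (B *m C) k j *: tnth e k).
    under eq_bigr do rewrite linearZ /= f1E scaler_sumr.
    rewrite exchange_big; apply: eq_bigr => k _; rewrite !mxE scaler_suml.
    by apply: eq_bigr => i _; rewrite scalerA mulrC.
  rewrite BC (bigD1 j) //= big1 => [|k kj]; first by rewrite mxE eqxx scale1r addr0.
  by rewrite mxE (negPf kj) scale0r.
exists f => //; exists g.
  exact: comp_id (mulVmx unitA) gE fE.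
exact: comp_id (mulmxV unitA) fE gE.
Qed.

Lemma morph_basis (br : {bilinear V -> V -> V}) (f : 'End(V)) :
    (forall i j, f (br (tnth e i) (tnth e j)) = br (f (tnth e i)) (f (tnth e j))) ->
  {morph f : u v / br u v}.
Proof.
move=> brE u v.
have brE' j : f (br u (tnth e j)) = br (f u) (f (tnth e j)).
  rewrite (coord_basis be (memvf u)) (linear_sumlz br) !(linear_sum f).
  rewrite (linear_sumlz br); apply: eq_bigr => i _.
  by rewrite (linearZl_LR br) !linearZ /= (linearZl_LR br) -!tnth_nth brE.
rewrite (coord_basis be (memvf v)) (linear_sumr br) !(linear_sum f).
rewrite (linear_sumr br); apply: eq_bigr => j _.
by rewrite (linearZr_LR br) !linearZ /= -!tnth_nth brE'.
Qed.

Lemma morph_basis_alt (br : {bilinear V -> V -> V}) (f : 'End(V)) :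
    (forall u, br u u = 0) ->
    (forall i j : 'I_n, (i < j)%N ->
      f (br (tnth e j) (tnth e i)) = br (f (tnth e j)) (f (tnth e i))) ->
  {morph f : u v / br u v}.
Proof.
move=> alt brE; apply: morph_basis => i j.
have [/brE //|/brE ji|/val_inj->] := ltngtP j i; last by rewrite !alt linear0.
by rewrite (alt_anticomm alt (tnth e i)) linearN /= ji [RHS](alt_anticomm alt).
Qed.
End Linear.

(** [e3] acts on the abelian plane <e1, e2> as a Jordan block, with which the block (a, b; 0, a)
    commutes; the part c e1 + d e2 of the image of [e3] brackets trivially with the plane. *)
Lemma lie_automorphism_aut_mx (R : realType) (V : vectType R)
    (br : {bilinear V -> V -> V}) (e1 e2 e3 : V) (a b c d : R)
    (e := [tuple e1; e2; e3]) :
    basis_of fullv e -> (forall u, br u u = 0) ->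
    br e2 e1 = 0 -> br e3 e1 = e1 -> br e3 e2 = e1 + e2 -> a != 0 ->
  exists2 phi : 'End(V), lie_automorphism br phi
    & forall j, phi (tnth e j) = \sum_i aut_mx a b c d i j *: tnth e i.
Proof.
move=> be alt br21 br31 br32 a0.
have [|phi bphi phiE] := exists_bij_lfun be (A := aut_mx a b c d).
  by rewrite unitmxE det_mx3 unitfE !(mul0r, mulr0, subr0, addr0) mulr1 mulf_neq0.
exists phi => //; split=> //; apply: (morph_basis_alt be) => // i j.
have phi1 : phi e1 = a *: e1.
  by have := phiE 0; rewrite !big_ord_recl big_ord0 !mxE /= !scale0r !addr0.
have phi2 : phi e2 = b *: e1 + a *: e2.
  by have := phiE 1; rewrite !big_ord_recl big_ord0 !mxE /= !scale0r !addr0.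
have phi3 : phi e3 = c *: e1 + d *: e2 + e3.
  have := phiE 2%:R.
  by rewrite !big_ord_recl big_ord0 !mxE /= scale1r addr0 addrA.
have br12 : br e1 e2 = 0 by rewrite (alt_anticomm alt) br21 oppr0.
have bE := (linearDl br, linearDr br, linearZl_LR br, linearZr_LR br,
  br12, br21, br31, br32, alt).
case: i j => [[|[|[|//]]] ilt] [[|[|[|//]]] jlt] //= _;
  rewrite !(tnth_nth 0) /= ?br21 ?br31 ?br32 ?linear0 ?linearD ?phi1 ?phi2 ?phi3
    ?bE /= !(scaler0, addr0, add0r) //.
by rewrite phi1 phi2 scalerDr addrCA.
Qed.

Lemma leading_minor_le0 (R : realType) (V : vectType R)
  (h : {symmetric V}) (e : 3.-tuple V) : signature_ppm h ->
  let H := form_mx e h in H 0 0 < 0 -> H 0 0 * H 1 1 <= H 0 1 ^+ 2.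
Proof. by move=> sgn; rewrite /= !mxE; exact: reverse_cauchy_schwarz. Qed.

Lemma form_mx_pullback (R : realType) (V : vectType R) (n : nat) (b : n.-tuple V)
    (phi : 'End(V)) (h : {symmetric V}) :
  form_mx b (pullback phi h) = form_mx (map_tuple phi b) h.
Proof. by apply/matrixP => i j; rewrite !mxE !tnth_map. Qed.

Lemma form_mx_end (R : realType) (V : vectType R) (n : nat) (b : n.-tuple V)
    (phi : 'End(V)) (h : {symmetric V}) : basis_of fullv b ->
  form_mx b (pullback phi h) = (end_mx b phi)^T *m form_mx b h *m end_mx b phi.
Proof.
move=> bb; rewrite form_mx_pullback; apply: form_mx_change => j.
by rewrite tnth_map {1}(basis_expand (phi _) bb); apply: eq_bigr => i _; rewrite mxE.
Qed.

(** * Normal forms of the metrics on g1 *)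

Theorem theorem3p12 (R : realType) (g1 : vectType R)
    (br : {bilinear g1 -> g1 -> g1}) (hbr : lie_bracket br)
    (x y z : g1) (hb : basis_of fullv [tuple x; y; z])
    (hxy : br x y = 0) (hzx : br z x = y) (hzy : br z y = - x + 2 *: y)
    (h : {symmetric g1}) (hh : lorentzian h) :
  exists h' : {symmetric g1},
    [/\ lorentzian h',
        equiv_up_to_aut br [tuple x; y; z] h h'
      & exists (mu nu : R) (M : 'M[R]_3),
          [/\ 0 < mu, 0 < nu, M \in normal_forms mu nu
            & form_mx [tuple x; y; z] h' = (Q_mx R)^T *m M *m Q_mx R]].
Proof.
have [alt _] := hbr; have [_ sgn] := hh.
pose e := [tuple - x + y; - x + 2 *: y; z].
(* That is, x = -2 x1 + x2 and y = -x1 + x2. *)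
have QE j : tnth [tuple x; y; z] j = \sum_i Q_mx R i j *: tnth e i.
  rewrite !big_ord_recl big_ord0 /e.
  case: j => -[|[|[|//]]] ?; rewrite !mxE !(tnth_nth 0) /=.
  - rewrite scale0r !addr0 scale1r scaleNr scalerDr scalerN opprD opprK.
    by rewrite addrACA addNr addr0 scaler_nat mulr2n addrK.
  - rewrite scale0r !addr0 scale1r scaleN1r opprD opprK addrACA subrr add0r.
    by rewrite scaler_nat mulr2n addKr.
  - by rewrite !scale0r scale1r !add0r addr0.
have be : basis_of fullv e.
  rewrite basisEdim (size_basis hb) leqnn andbT -(span_basis hb).
  apply/span_subvP => _ /tnthP[j ->]; rewrite QE; apply: memv_suml => i _.
  by rewrite memvZ // memv_span // mem_tnth.
have [a [b [c [d [mu [nu [a0 mu0 nu0 nf]]]]]]] :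
    exists a b c d mu nu, [/\ a != 0, 0 < mu, 0 < nu
    & pull_mx (form_mx e h) a b c d \in normal_forms mu nu].
  apply: normal_form (det_form_mx_lt0 sgn be) (leading_minor_le0 sgn).
  by apply/matrixP => i j; rewrite !mxE symmetricC.
have hyx : br y x = 0 by rewrite (alt_anticomm alt) hxy oppr0.
have e21 : br (- x + 2 *: y) (- x + y) = 0.
  rewrite (linearDl br) !(linearDr br) !(linearZl_LR br) !(linearNl br).
  by rewrite !(linearNr br) !alt hxy hyx !(scaler0, oppr0, addr0).
have e31 : br z (- x + y) = - x + y.
  by rewrite (linearDr br) (linearNr br) hzx hzy scaler_nat mulr2n addrCA addKr.
have e32 : br z (- x + 2 *: y) = (- x + y) + (- x + 2 *: y).
  by rewrite {1}scaler_nat mulr2n addrA (linearDr br) e31 hzy.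
have [phi aut_phi phiE] :=
  lie_automorphism_aut_mx b c d be alt e21 e31 e32 a0.
exists (pullback phi h); split.
- by apply: pullback_lorentzian hh; case: aut_phi.
- by exists phi; split; last exact: form_mx_end.
exists mu, nu, (pull_mx (form_mx e h) a b c d); split=> //.
(* The change from {x, y, z} to [e] contributes [Q_mx]; in [e] the pullback has the matrix of [h] on
   the images under [phi], whose coordinates are the columns of [aut_mx]. *)
rewrite (form_mx_change _ QE) form_mx_pullback; congr (_ *m _ *m _).
by apply: form_mx_change => j; rewrite tnth_map.
Qed.
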